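(* There is $N$ such that for every $n\ge N$ the following holds: for every root $x_0$ of the Jeff polynomial $J(x)$ other than its smallest root, the Mutt polynomial $M(x)$ has a root in the interval \[ \left[x_0-\frac{3}{10n^2},\ x_0+\frac{1}{2n^2}\right). \]
   Context: $T_m,U_m$ are Chebyshev polynomials: $T_m(\cos\theta)=\cos m\theta$, $U_m(\cos\theta)=\sin((m+1)\theta)/\sin\theta$. The Mutt polynomial is $M(x)=\dfrac{(2n-1)T_{2n+1}(\sqrt{x})+(2n+1)T_{2n-1}(\sqrt{x})}{x\sqrt{x}}$, a polynomial in $x$ of degree $n-1$. For an indeterminate $x$ let $(SU_{2n-1})(z)=\frac12\int_{-z}^{z}U'_{2n-1}(t)(x-t^2)\,dt=(x-z^2)U_{2n-1}(z)+\frac{T_{2n+1}(z)}{2n+1}+\frac{T_{2n-1}(z)}{2n-1}$, and let $\zeta_1,\dots,\zeta_{n-1}$ be the positive roots of $U'_{2n-1}$. The Jeff polynomial $J(x)\in\mathbb{Z}[x]$ is the (up to sign unique) integer polynomial with coprime coefficients that is a nonzero real scalar multiple of $\prod_{i=1}^{n-1}(SU_{2n-1})(\zeta_i)$; it has degree $n-1$ and real roots. *)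

(* Defs.v *)
From HB Require Import structures.
From mathcomp Require Import all_boot all_order all_algebra.
Set Implicit Arguments. Unset Strict Implicit. Unset Printing Implicit Defensive.
Import Order.TTheory GRing.Theory Num.Theory.
Local Open Scope ring_scope.

Section Cheb.
Variable R : rcfType.

Fixpoint chebrec (p0 p1 : {poly R}) (m : nat) : {poly R} :=
  match m with
  | 0%N => p0
  | m'.+1 => chebrec p1 (2%:R *: 'X * p1 - p0) m'
  end.

Definition chebT (m : nat) : {poly R} := chebrec 1 'X m.
Definition chebU (m : nat) : {poly R} := chebrec 1 (2%:R *: 'X) m.

(* numerator of the Mutt polynomial, as a polynomial in t = sqrt x :
   Q(t) = (2n-1) T_{2n+1}(t) + (2n+1) T_{2n-1}(t), an odd polynomial divisible by t^3 *)
Definition mutt_num (n : nat) : {poly R} :=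
  (n.*2.-1)%:R *: chebT n.*2.+1 + (n.*2.+1)%:R *: chebT n.*2.-1.

(* Mutt polynomial M(x) = Q(sqrt x) / (x sqrt x), i.e. the polynomial of degree
   n-1 whose k-th coefficient is the (2k+3)-th coefficient of Q. *)
Definition mutt (n : nat) : {poly R} := \poly_(k < n) (mutt_num n)`_(2 * k + 3).

(* (S U_{2n-1})(z) as a (linear) polynomial in the indeterminate x:
   (x - z^2) U_{2n-1}(z) + T_{2n+1}(z)/(2n+1) + T_{2n-1}(z)/(2n-1) *)
Definition SU (n : nat) (z : R) : {poly R} :=
  ('X - (z ^+ 2)%:P) * ((chebU n.*2.-1).[z])%:P
  + ((chebT n.*2.+1).[z] / (n.*2.+1)%:R + (chebT n.*2.-1).[z] / (n.*2.-1)%:R)%:P.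

End Cheb.

(* Main.v *)
Require Import Defs.
From HB Require Import structures.
From mathcomp Require Import all_boot all_order all_algebra.
From mathcomp Require Import ring lra zify.
From mathcomp Require Import polyrcf.
From mathcomp Require Import boolp classical_sets reals topology normedtype derive realfun trigo.
Import Order.TTheory GRing.Theory Num.Theory.
Import numFieldNormedType.Exports.
Local Open Scope ring_scope.

(* Write m = 2n and let z = cos x be a positive critical point of U_(m-1), so that
   z U_(m-1)(z) = m T_m(z).  This relation gives SU(z) = U_(m-1)(z) (X - z^2 + 2/(m^2-1)),
   so the roots of J are the numbers z^2 - 2/(m^2-1); and the substitution
   x -> pi/2 - x shows that the roots of M are the numbers 1 - z^2.  The critical points
   z_1 > ... > z_(n-1) are the cosines of the angles x_i with m x_i = i pi + pi/2 - b_i,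
   0 < b_i < pi/2 and m sin b_i sin x_i = cos b_i cos x_i.  The root of J attached to z_i,
   i < n-1, is matched with the root of M attached to z_j, j = n-1-i: as
   x_i + x_j = pi/2 - d with d = (b_i + b_j)/m,
     z_i^2 + z_j^2 - 1 = sin d (2 sin x_i sin x_j + sin d),
   which is close to 1/(2n^2) by elementary bounds on d.

   The trigonometric argument takes place over the reals.  Its conclusion is carried to an
   arbitrary real closed field by rational intervals that isolate the z_i and have endpoints
   close enough to satisfy the same inequalities: U'_(m-1) changes sign on each of them,
   and its degree leaves room for no other positive root. *)

(** * Polynomial identities for T and U *)

Lemma chebrecSS (R : rcfType) (p q : {poly R}) k :
  chebrec p q k.+2 = 2%:R *: 'X * chebrec p q k.+1 - chebrec p q k.
Proof. by elim: k p q => [//|k IH] p q; apply: IH. Qed.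

Lemma chebT_rec (R : rcfType) k :
  chebT R k.+2 = 2%:R * 'X * chebT R k.+1 - chebT R k.
Proof. by rewrite /chebT chebrecSS -mul_polyC polyCMn. Qed.

Lemma chebU_rec (R : rcfType) k :
  chebU R k.+2 = 2%:R * 'X * chebU R k.+1 - chebU R k.
Proof. by rewrite /chebU chebrecSS -mul_polyC polyCMn. Qed.

(** These are the addition formulas for the cosine and the sine of (k+1) x + x. *)
Lemma chebTU_succ (R : rcfType) k :
  chebT R k.+2 = 'X * chebT R k.+1 - (1 - 'X ^+ 2) * chebU R k /\
  chebU R k.+1 = 'X * chebU R k + chebT R k.+1.
Proof.
(* The recurrence has order two, so the induction carries two consecutive indices; several
   inductions below have the same shape. *)
suff [] : (chebT R k.+2 = 'X * chebT R k.+1 - (1 - 'X ^+ 2) * chebU R k /\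
  chebU R k.+1 = 'X * chebU R k + chebT R k.+1) /\
  (chebT R k.+3 = 'X * chebT R k.+2 - (1 - 'X ^+ 2) * chebU R k.+1 /\
  chebU R k.+2 = 'X * chebU R k.+1 + chebT R k.+2) by [].
elim: k => [|k [[IH1 IH2] [IH3 IH4]]].
  rewrite !chebT_rec chebU_rec /chebT /chebU /= -mul_polyC polyCMn.
  by do !split; ring.
by split=> //; rewrite (chebT_rec _ k.+2) (chebU_rec _ k.+1) IH3 IH4; split; ring.
Qed.

Section Evaluation.
Variables (R : rcfType) (x : R).

Lemma horner_chebT_succ k :
  (chebT R k.+2).[x] = x * (chebT R k.+1).[x] - (1 - x ^+ 2) * (chebU R k).[x].
Proof. by have [-> _] := chebTU_succ R k; rewrite !hornerE. Qed.

Lemma horner_chebU_succ k :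
  (chebU R k.+1).[x] = x * (chebU R k).[x] + (chebT R k.+1).[x].
Proof. by have [_ ->] := chebTU_succ R k; rewrite !hornerE. Qed.

Lemma horner_chebT_pred k :
  (chebT R k).[x] = x * (chebT R k.+1).[x] + (1 - x ^+ 2) * (chebU R k).[x].
Proof.
have := horner_chebT_succ k; rewrite chebT_rec -polyCMn !hornerE => h; lra.
Qed.

(** This is Pythagoras at the angle (k+1) x: T_(k+1) is its cosine, and U_k is its sine divided by
    sin x. *)
Lemma cheb_pell k :
  (chebT R k.+1).[x] ^+ 2 + (1 - x ^+ 2) * (chebU R k).[x] ^+ 2 = 1.
Proof.
elim: k => [|k IH].
  by rewrite /chebT /chebU /= hornerX hornerC; ring.
by rewrite horner_chebT_succ horner_chebU_succ -[RHS]IH; ring.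
Qed.

End Evaluation.

(** Differentiating sin x U_k(cos x) = sin((k+1) x) gives this identity. The algebraic proof first
    establishes a form in U_k and U_(k+1) alone, on which the recurrence of U acts directly. *)
Lemma deriv_chebU (R : rcfType) k :
  (1 - 'X ^+ 2) * (chebU R k)^`() = 'X * chebU R k - k.+1%:R * chebT R k.+1.
Proof.
suff derivU j : (1 - 'X ^+ 2) * (chebU R j)^`()
    = j.+2%:R * 'X * chebU R j - j.+1%:R * chebU R j.+1.
  by rewrite derivU (chebTU_succ R k).2; ring.
suff [] : (1 - 'X ^+ 2) * (chebU R j)^`()
    = j.+2%:R * 'X * chebU R j - j.+1%:R * chebU R j.+1 /\
  (1 - 'X ^+ 2) * (chebU R j.+1)^`()
    = j.+3%:R * 'X * chebU R j.+1 - j.+2%:R * chebU R j.+2 by [].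
elim: j => [|j [IH1 IH2]].
  rewrite chebU_rec /chebU /= -mul_polyC polyCMn derivM derivX -polyCMn !derivC.
  by rewrite polyCMn; split; ring.
split=> //; rewrite (chebU_rec _ j.+1) {1}chebU_rec derivB -mulrA derivM derivM derivX.
rewrite -polyCMn derivC polyCMn.
transitivity (2%:R * (1 - 'X ^+ 2) * chebU R j.+1
  + 2%:R * 'X * ((1 - 'X ^+ 2) * (chebU R j.+1)^`()) - (1 - 'X ^+ 2) * (chebU R j)^`()).
  by ring.
by rewrite IH1 IH2 chebU_rec; ring.
Qed.

(** * Critical points of U, roots of J and the complementary angle *)

Section CriticalPoints.
Variables (R : rcfType) (k : nat) (z : R).
Hypothesis z_crit : root (chebU R k)^`() z.

Lemma critical_chebU : z * (chebU R k).[z] = k.+1%:R * (chebT R k.+1).[z].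
Proof.
have := congr1 (horner^~ z) (deriv_chebU R k).
rewrite !hornerE (rootP z_crit) mulr0 => /esym/eqP.
by rewrite subr_eq0 => /eqP ->; rewrite -polyCMn hornerE.
Qed.

(** At a critical point a zero of U_k would also be a zero of T_(k+1), against [cheb_pell]. *)
Lemma critical_chebU_neq0 : (chebU R k).[z] != 0.
Proof.
apply/eqP => U0; have := critical_chebU; rewrite U0 mulr0 => /esym/eqP.
rewrite mulf_eq0 pnatr_eq0 /= => /eqP T0; have := cheb_pell R z k.
by rewrite T0 U0 => /eqP; rewrite expr0n mulr0 addr0 eq_sym oner_eq0.
Qed.

End CriticalPoints.

(** Put m = 2n and u = U_(m-1)(z). At z, T_(m+1) = z T_m - (1 - z^2) u and T_(m-1) = z T_m + (1 -
    z^2) u, while T_m = z u / m. Hence T_(m+1)/(m+1) + T_(m-1)/(m-1) = 2 u / (m^2 - 1), and the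
    nonzero factor u splits off. *)
Lemma root_SU (R : rcfType) n (z x : R) : (0 < n)%N ->
  root (chebU R n.*2.-1)^`() z ->
  root (SU n z) x = (x == z ^+ 2 - 2%:R / (4 * n ^ 2 - 1)%:R).
Proof.
case: n => // n _ zc; rewrite /SU doubleS /= in zc *.
have [cr U0] := (critical_chebU _ _ _ zc, critical_chebU_neq0 _ _ _ zc).
have -> : (4 * n.+1 ^ 2 - 1 = n.*2.+3 * n.*2.+1)%N by nia.
rewrite natrM; set u := (chebU _ _).[z] in cr U0 *.
have m1 : (n.*2.+1%:R : R) != 0 by rewrite pnatr_eq0.
have m3 : (n.*2.+3%:R : R) != 0 by rewrite pnatr_eq0.
have m2 : (n.*2.+2%:R : R) != 0 by rewrite pnatr_eq0.
have T2 : (chebT R n.*2.+2).[z] = z * u / n.*2.+2%:R by rewrite cr mulrC mulKf.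
rewrite rootE (_ : _.[x] = u * (x - (z ^+ 2 - 2%:R / (n.*2.+3%:R * n.*2.+1%:R)))).
  by rewrite mulf_eq0 (negPf U0) subr_eq0.
rewrite !(hornerD, hornerM, hornerN, hornerX, hornerC) horner_chebT_succ (horner_chebT_pred _ _ n.*2.+1) -/u T2.
rewrite -(addn3 n.*2) -(addn2 n.*2) -(addn1 n.*2) !natrD in m1 m2 m3 *.
by field; rewrite m1 m2 m3.
Qed.

(* For z = cos x and t = sin x this is the substitution x -> pi / 2 - x. *)
Lemma cheb_complement (R : rcfType) (z t : R) n : t ^+ 2 = 1 - z ^+ 2 ->
  (chebT R n.*2.+2).[t] = (-1) ^+ n.+1 * (chebT R n.*2.+2).[z] /\
  z * (chebU R n.*2.+1).[t] = (-1) ^+ n * t * (chebU R n.*2.+1).[z].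
Proof.
move=> tz; elim: n => [|n [IHT IHU]].
  rewrite chebT_rec /chebT /chebU /= -polyCMn !(hornerD, hornerN, hornerM, hornerZ, hornerC, hornerX).
  by rewrite expr1 expr0; split; lra.
(* Raising the index by two adds twice the angle, and [2%:R * x ^+ 2 - 1] is the cosine of the
   doubled angle. *)
have stepT x : (chebT R n.*2.+4).[x] = (2%:R * x ^+ 2 - 1) * (chebT R n.*2.+2).[x]
    - 2%:R * x * (1 - x ^+ 2) * (chebU R n.*2.+1).[x].
  by rewrite (horner_chebT_succ _ x n.*2.+2) (horner_chebT_succ _ x n.*2.+1) (horner_chebU_succ _ x n.*2.+1); ring.
have stepU x : (chebU R n.*2.+3).[x] = (2%:R * x ^+ 2 - 1) * (chebU R n.*2.+1).[x]
    + 2%:R * x * (chebT R n.*2.+2).[x].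
  by rewrite (horner_chebU_succ _ x n.*2.+2) (horner_chebU_succ _ x n.*2.+1) (horner_chebT_succ _ x n.*2.+1); ring.
rewrite doubleS; split.
  rewrite !stepT tz.
  transitivity ((1 - 2%:R * z ^+ 2) * (chebT R n.*2.+2).[t]
    - 2%:R * t * z * (z * (chebU R n.*2.+1).[t])); first by ring.
  rewrite IHT IHU exprS.
  transitivity ((-1) ^+ n.+2 * (2%:R * z ^+ 2 - 1) * (chebT R n.*2.+2).[z]
    - 2%:R * z * (-1) ^+ n * t ^+ 2 * (chebU R n.*2.+1).[z]); first by rewrite !exprS; ring.
  by rewrite tz !exprS; ring.
rewrite !stepU mulrDr mulrCA IHU IHT tz !exprS; ring.
Qed.

(** * Coefficients and roots of the Mutt polynomial *)

Lemma coef_chebT_parity (R : rcfType) k i : odd (k + i) -> (chebT R k)`_i = 0.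
Proof.
suff [] : (forall i, odd (k + i) -> (chebT R k)`_i = 0) /\
  (forall i, odd (k.+1 + i) -> (chebT R k.+1)`_i = 0) by move=> h _; apply: h.
elim: k {i} => [|k [IH1 IH2]]; split=> //.
- by case=> // i _; rewrite /chebT /= coefC.
- by case=> [|[|i]] // _; rewrite /chebT /= coefX.
case=> [|i] hi; rewrite chebT_rec coefB -mulrA -polyCMn coefCM coefXM /=.
  by rewrite mulr0 sub0r IH1 ?oppr0 //; move: hi; rewrite !addn0 /= negbK.
rewrite IH2 ?mulr0 ?sub0r ?IH1 ?oppr0 //; move: hi; rewrite !addnS !addSn /= !negbK //.
Qed.

Lemma size_chebT (R : rcfType) k : (size (chebT R k) <= k.+1)%N.
Proof.
suff [] : (size (chebT R k) <= k.+1)%N /\ (size (chebT R k.+1) <= k.+2)%N by [].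
elim: k => [|k [IH1 IH2]]; first by rewrite /chebT /= size_polyC size_polyX oner_eq0.
split=> //; rewrite chebT_rec.
have h : (size (2%:R * 'X * chebT R k.+1)%R <= k.+3)%N.
  rewrite -polyCMn mul_polyC -scalerAl mulrC; apply: leq_trans (size_scale_leq _ _) _.
  by apply: leq_trans (size_polyMleq _ _) _; rewrite size_polyX addn2.
apply: leq_trans (size_polyD _ _) _.
by rewrite geq_max h size_polyN (leq_trans IH1) // ltnW.
Qed.

Lemma size_chebU (R : rcfType) k : (size (chebU R k) <= k.+1)%N.
Proof.
elim: k => [|k IH]; first by rewrite /chebU /= size_polyC oner_eq0.
rewrite (chebTU_succ R k).2; apply: leq_trans (size_polyD _ _) _.
rewrite geq_max size_chebT andbT mulrC.
by apply: leq_trans (size_polyMleq _ _) _; rewrite size_polyX addn2.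
Qed.

(** The linear coefficient makes the terms of degree one cancel in [mutt_num]; the constant one
    shows that T_(2n) does not vanish at 0. *)
Lemma coef_chebT_low (R : rcfType) n :
  (chebT R n.*2)`_0 = (-1) ^+ n /\ (chebT R n.*2.+1)`_1 = (-1) ^+ n * n.*2.+1%:R.
Proof.
elim: n => [|n [IH1 IH2]].
  by rewrite /chebT /= coefC coefX mulr1.
have T0 : (chebT R n.*2.+2)`_0 = (-1) ^+ n.+1.
  by rewrite chebT_rec coefB -mulrA -polyCMn coefCM coefXM /= IH1 exprS; ring.
rewrite doubleS; split=> //.
rewrite chebT_rec coefB -mulrA -polyCMn coefCM coefXM /= T0 IH2 exprS.
by rewrite -(addn3 n.*2) -(addn1 n.*2) !natrD; ring.
Qed.

(** The coefficients that the definition of [mutt] leaves out are all zero: those of even degree by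
    parity, the linear one by cancellation, and those beyond degree 2n+1 by size. *)
Lemma mutt_numE (R : rcfType) n : (0 < n)%N ->
  mutt_num R n = 'X ^+ 3 * (mutt R n \Po 'X ^+ 2).
Proof.
case: n => // n _; apply/polyP => i.
rewrite coefXnM coef_comp_poly_Xn // /mutt coef_poly.
have odd0 j : ~~ odd j -> (mutt_num R n.+1)`_j = 0.
  move=> hj; rewrite /mutt_num doubleS /= coefD !coefZ.
  by rewrite !coef_chebT_parity ?mulr0 ?addr0 //= oddD odd_double /= ?negbK.
case: ltnP => i3.
  case: i i3 => [|[|[|]]] // _; [exact: odd0 | | exact: odd0].
  rewrite /mutt_num doubleS coefD !coefZ /=.
  rewrite (coef_chebT_low R n).2 -doubleS (coef_chebT_low R n.+1).2 doubleS exprS.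
  ring.
case: ifPn => [/dvdnP [k ik]|hd]; last first.
  by rewrite odd0 //; move: hd; rewrite dvdn2 oddB //= addbT => /negPn.
have -> : i = (2 * k + 3)%N by lia.
rewrite addnK mulKn //; case: ltnP => // kn.
rewrite nth_default // /mutt_num.
apply: leq_trans (size_polyD _ _) _; rewrite geq_max.
have [h1 h2] := (size_chebT R n.+1.*2.+1, size_chebT R n.+1.*2.-1).
rewrite !(leq_trans (size_scale_leq _ _)) //.
  by apply: leq_trans h2 _; lia.
by apply: leq_trans h1 _; lia.
Qed.

(** At t = sqrt(1 - z^2) the numerator is 2 m t T_m(t) + 2 z^2 U_(m-1)(t), with m = 2n. By
    [cheb_complement] this is a multiple of z U_(m-1)(z) - m T_m(z), which vanishes at a critical
    point; the factor t^3 is nonzero. *)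
Lemma root_mutt (R : rcfType) n (z : R) : (0 < n)%N -> 0 < z < 1 ->
  root (chebU R n.*2.-1)^`() z -> root (mutt R n) (1 - z ^+ 2).
Proof.
case: n => // n _ /andP[z0 z1] zc.
have z21 : 0 < 1 - z ^+ 2 by nra.
pose t := Num.sqrt (1 - z ^+ 2).
have tz : t ^+ 2 = 1 - z ^+ 2 by rewrite sqr_sqrtr // ltW.
have t0 : t != 0 by rewrite gt_eqF // sqrtr_gt0.
have cr := critical_chebU _ _ _ zc.
have [hT hU] := cheb_complement R z t n tz.
rewrite doubleS /= in zc cr.
suff : (mutt_num R n.+1).[t] = 0.
  rewrite mutt_numE // hornerM horner_comp !hornerXn tz => /eqP.
  by rewrite mulf_eq0 expf_eq0 (negPf t0).
rewrite /mutt_num doubleS /= hornerD !hornerZ.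
rewrite horner_chebT_succ (horner_chebT_pred _ _ n.*2.+1) tz hT.
transitivity (2%:R * n.*2.+2%:R * t * ((-1) ^+ n.+1 * (chebT R n.*2.+2).[z])
  + 2%:R * z * (z * (chebU R n.*2.+1).[t])).
  by rewrite -(addn3 n.*2) -(addn2 n.*2) -(addn1 n.*2) !natrD; ring.
rewrite hU exprS.
transitivity (2%:R * t * (-1) ^+ n * (z * (chebU R n.*2.+1).[z] - n.*2.+2%:R * (chebT R n.*2.+2).[z])).
  by ring.
by rewrite cr subrr mulr0.
Qed.

(** * Transfer between real closed fields *)

(** The order of the quantifiers matters: one rational polynomial serves every field, so a sign at a
    rational point is the same in all of them. *)
Lemma chebU_over_rat k :
  exists p : {poly rat}, forall R : rcfType, chebU R k = map_poly ratr p.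
Proof.
suff [] : (exists p : {poly rat}, forall R : rcfType, chebU R k = map_poly ratr p) /\
  (exists p : {poly rat}, forall R : rcfType, chebU R k.+1 = map_poly ratr p) by [].
elim: k => [|k [[p hp] [q hq]]].
  split; [exists 1|exists (2%:R *: 'X)] => R; rewrite /chebU /= ?rmorph1 //.
  by rewrite map_polyZ map_polyX /= rmorph_nat.
split; [by exists q|exists (2%:R * 'X * q - p)] => R.
by rewrite chebU_rec hp hq !(rmorphB, rmorphM, rmorph_nat) /= map_polyX.
Qed.

(** U_(2n-1) is odd, so its derivative is even and the opposite of a root is again a root. *)
Lemma deriv_chebU_even (R : rcfType) n (x : R) : (0 < n)%N ->
  (chebU R n.*2.-1)^`().[- x] = (chebU R n.*2.-1)^`().[x].
Proof.
case: n => // n _; rewrite doubleS /=.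
have comp_opp k : chebU R k \Po - 'X = (-1) ^+ k * chebU R k.
  suff [] : chebU R k \Po - 'X = (-1) ^+ k * chebU R k /\
     chebU R k.+1 \Po - 'X = (-1) ^+ k.+1 * chebU R k.+1 by [].
  elim: k => [|k [IH1 IH2]].
    rewrite /chebU /= comp_polyC comp_polyZ comp_polyX.
    by rewrite expr0 expr1 mul1r mulN1r scalerN.
  split=> //; rewrite chebU_rec -polyCMn comp_polyB !comp_polyM comp_polyX comp_polyC.
  by rewrite IH1 IH2 !exprS; ring.
have /(congr1 (fun p => (deriv p).[x])) := comp_opp n.*2.+1.
rewrite deriv_comp derivN derivX exprS -mul2n exprM sqrrN expr1n expr1n mulr1 mulN1r derivN.
by rewrite mulrN1 !hornerN horner_comp hornerN hornerX => /oppr_inj.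
Qed.

Lemma size_deriv_chebU (R : rcfType) k : (size (chebU R k)^`() <= k)%N.
Proof.
apply: (leq_trans (size_poly _ _)).
by have := size_chebU R k; case: (size _).
Qed.

(** With their opposites, n-1 positive roots make 2n-2 roots, as many as the degree of U'_(2n-1)
    allows. Both counting arguments below rest on this list. *)
Lemma all_sym_roots (R : rcfType) n (p : {poly R}) (r : nat -> R) :
  (0 < n)%N ->
  (forall x, p.[- x] = p.[x]) ->
  (forall i, (0 < i < n)%N -> 0 < r i /\ root p (r i)) ->
  (forall i j, (0 < i)%N -> (i < j)%N -> (j < n)%N -> r j < r i) ->
  let rs := [seq r i | i <- iota 1 n.-1] ++ [seq - r i | i <- iota 1 n.-1] in
  [/\ uniq rs, all (root p) rs & size rs = n.*2.-2].
Proof.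
move=> n0 even rP r_decr rs.
have inI i : (i \in iota 1 n.-1) = (0 < i < n)%N by rewrite mem_iota; lia.
have r_inj : {in iota 1 n.-1 &, injective r}.
  move=> i j; rewrite !inI => /andP[i0 i1] /andP[j0 j1] /eqP.
  case: (ltngtP i j) => // h.
    by rewrite gt_eqF // r_decr.
  by rewrite lt_eqF // r_decr.
split.
- rewrite cat_uniq !map_inj_in_uniq ?iota_uniq ?andbT //=; last first.
    by move=> i j hi hj /oppr_inj; apply: r_inj.
  apply/hasPn => x /mapP[i]; rewrite inI => hi ->.
  apply/negP => /mapP[j]; rewrite inI => hj h.
  by have [[+ _] [+ _]] := (rP i hi, rP j hj); lra.
- rewrite all_cat; apply/andP; split; apply/allP => x /mapP[i]; rewrite inI => hi ->.
    by have [] := rP i hi.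
  by have [_] := rP i hi; rewrite !rootE even.
- by rewrite size_cat !size_map size_iota; lia.
Qed.

(** The intermediate value theorem puts a root in each interval, and the degree bound leaves no
    other positive root. The intervals decrease with the index, as cosines of increasing angles
    do. *)
Lemma isolated_roots (R : rcfType) n (p : {poly R}) (a b : nat -> R) :
  (0 < n)%N -> p != 0 -> (size p <= n.*2.-1)%N ->
  (forall x, p.[- x] = p.[x]) ->
  (forall i, (0 < i < n)%N -> [/\ 0 < a i, a i < b i & p.[a i] * p.[b i] < 0]) ->
  (forall i j, (0 < i)%N -> (i < j)%N -> (j < n)%N -> b j <= a i) ->
  exists r : nat -> R,
    [/\ forall i, (0 < i < n)%N -> [/\ a i < r i, r i < b i & root p (r i)],
        forall i j, (0 < i)%N -> (i < j)%N -> (j < n)%N -> r j < r i &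
        forall z, 0 < z -> root p z -> exists2 i, (0 < i < n)%N & z = r i].
Proof.
move=> n0 pN0 size_p even abP b_le_a.
have ex_r i : {x : R | (0 < i < n)%N -> [/\ a i < x, x < b i & root p x]}.
  case: (boolP (0 < i < n)%N) => hi; last by exists 0.
  have [_ /ltW le_ab pab] := abP i hi.
  have [x + px] := poly_ivtoo le_ab pab; rewrite in_itv /= => /andP[ax xb].
  by exists x.
pose r i := sval (ex_r i); exists r.
have rP i : (0 < i < n)%N -> [/\ a i < r i, r i < b i & root p (r i)].
  exact: (svalP (ex_r i)).
have r_decr i j : (0 < i)%N -> (i < j)%N -> (j < n)%N -> r j < r i.
  move=> i0 ij jn.
  have [ai _ _] : [/\ a i < r i, r i < b i & root p (r i)] by apply: rP; lia.
  have [_ bj _] : [/\ a j < r j, r j < b j & root p (r j)] by apply: rP; lia.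
  exact: lt_trans bj (le_lt_trans (b_le_a i j i0 ij jn) ai).
split=> // z z0 pz.
have rP' i : (0 < i < n)%N -> 0 < r i /\ root p (r i).
  move=> hi; have [[a0 _ _] [ar _ pr]] := (abP i hi, rP i hi).
  by split=> //; apply: lt_trans ar.
have [uniq_rs root_rs size_rs] := all_sym_roots R n p r n0 even rP' r_decr.
set rs := _ ++ _ in uniq_rs root_rs size_rs.
have z_rs : z \in rs.
  apply/negPn/negP => zN.
  (* With z added, the list would have 2n-1 distinct roots in degree at most 2n-2. *)
  have := @max_poly_roots _ p (z :: rs) pN0.
  rewrite /= pz root_rs zN uniq_rs size_rs => /(_ isT isT) /leq_trans/(_ size_p); lia.
move: z_rs; rewrite mem_cat => /orP[] /mapP[i]; rewrite mem_iota => hi zE.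
  by exists i => //; lia.
have hi' : (0 < i < n)%N by lia.
by have [h _] := rP' i hi'; move: z0; rewrite zE oppr_gt0 ltNge (ltW h).
Qed.

(** The minimum starts from 1, which also covers an empty family. *)
Lemma lt_all_pos (R : realDomainType) (I : finType) (P : pred I) (f : I -> R) :
  (forall i, P i -> 0 < f i) -> exists2 e, 0 < e & forall i, P i -> e <= f i.
Proof.
move=> f_gt0; exists (\big[Num.min/1]_(i | P i) f i).
  by elim/big_ind: _ => // x y x0 y0; rewrite lt_min x0.
by move=> i Pi; apply: bigmin_le_cond.
Qed.

(** The numbers r_i and -r_i are all the roots of p, so p is a constant times the product of the X -
    z over them. Between two points closer than e to r_i, on either side of it, only the factor of
    r_i changes sign. *)
Lemma sign_change (R : rcfType) n (p : {poly R}) (r : nat -> R) (e : R) :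
  (0 < n)%N -> p != 0 -> (size p <= n.*2.-1)%N ->
  (forall x, p.[- x] = p.[x]) ->
  (forall i, (0 < i < n)%N -> e <= r i /\ root p (r i)) ->
  (forall i j, (0 < i)%N -> (i < j)%N -> (j < n)%N -> r j + e <= r i) ->
  forall i x y, (0 < i < n)%N -> 0 < x -> r i - e < x -> x < r i -> r i < y -> y < r i + e ->
    p.[x] * p.[y] < 0.
Proof.
move=> n0 pN0 size_p even rP gap i x y hi x0 ex xr ry ye.
have e0 : 0 < e by lra.
have rP' j : (0 < j < n)%N -> 0 < r j /\ root p (r j).
  by move=> /rP[h ?]; split=> //; lra.
have r_decr j k : (0 < j)%N -> (j < k)%N -> (k < n)%N -> r k < r j.
  by move=> j0 jk kn; have := gap j k j0 jk kn; lra.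
have [uniq_rs root_rs size_rs] := all_sym_roots R n p r n0 even rP' r_decr.
set rs := _ ++ _ in uniq_rs root_rs size_rs.
have ri_rs : r i \in rs.
  by rewrite mem_cat map_f // mem_iota; clear -hi n0; lia.
have size_pE : size p = (size rs).+1.
  apply/eqP; rewrite eqn_leq max_poly_roots // size_rs andbT.
  by apply: leq_trans size_p _; clear -n0; lia.
have pE := all_roots_prod_XsubC size_pE root_rs.
rewrite uniq_rootsE in pE.
have {pE}pE u : p.[u] = lead_coef p * \prod_(z <- rs) (u - z).
  rewrite {1}(pE uniq_rs) hornerZ horner_prod; congr (_ * _).
  by apply: eq_bigr => z _; rewrite !hornerE.
(* The factors of the two values are paired root by root: the pair of r_i is negative, every other
   pair positive. *)
rewrite !pE mulrACA -big_split /= -expr2 pmulr_rlt0; last first.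
  by rewrite exprn_even_gt0 //= lead_coef_eq0.
rewrite (bigD1_seq (r i)) //= nmulr_rlt0; last first.
  by rewrite nmulr_rlt0; lra.
rewrite big_seq_cond prodr_gt0 // => z /andP[z_rs zri].
suff [zx|zx] : x < z /\ y < z \/ z < x /\ z < y by nra.
have /andP[i0 ltin] := hi.
move: z_rs zri; rewrite mem_cat => /orP[] /mapP[j]; rewrite mem_iota => hj -> hne.
all: have /andP[j0 ltjn] : (0 < j < n)%N by clear -hj n0; lia.
  case: (ltngtP i j) hne => [ij _|ji _|-> /eqP //].
    by right; have := gap i j i0 ij ltjn; lra.
  by left; have := gap j i j0 ji ltin; lra.
have [h _] : 0 < r j /\ root p (r j) by apply: rP'; rewrite j0.
by right; lra.
Qed.

(** All the conditions on the r_i are strict and finite in number, so they share a positive slack e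
    and survive a small rational perturbation. *)
Lemma rational_isolation (R : realType) n (p : {poly rat}) (lo hi : rat) (r : nat -> R) :
  (0 < n)%N -> p != 0 -> (size p <= n.*2.-1)%N ->
  (forall x, (map_poly ratr p).[- x] = (map_poly ratr p).[x] :> R) ->
  (forall i, (0 < i < n)%N -> 0 < r i < 1 /\ root (map_poly ratr p) (r i)) ->
  (forall i j, (0 < i)%N -> (i < j)%N -> (j < n)%N -> r j < r i) ->
  (forall i j, (0 < i)%N -> (0 < j)%N -> (i + j)%N = n.-1 ->
     ratr lo < r i ^+ 2 + r j ^+ 2 - 1 < ratr hi) ->
  exists a b : nat -> rat,
  [/\ forall i, (0 < i < n)%N -> [/\ 0 < a i, a i < b i, b i < 1 & p.[a i] * p.[b i] < 0],
      forall i j, (0 < i)%N -> (i < j)%N -> (j < n)%N -> b j <= a i &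
      forall i j, (0 < i)%N -> (0 < j)%N -> (i + j)%N = n.-1 ->
        lo < a i ^+ 2 + a j ^+ 2 - 1 /\ b i ^+ 2 + b j ^+ 2 - 1 < hi].
Proof.
move=> n0 pN0 size_p even rP r_decr sumP.
have [e1 e1_gt0 e1P] : exists2 e, 0 < e &
    forall i : 'I_n, (0 < i)%N -> e <= Num.min (r i) (1 - r i).
  apply: lt_all_pos => i i0; have [|/andP[ri0 ri1] _] := rP i.
    by rewrite i0 ltn_ord.
  by rewrite lt_min ri0 subr_gt0.
have [e2 e2_gt0 e2P] : exists2 e, 0 < e &
    forall ij : 'I_n * 'I_n, (0 < ij.1)%N && (ij.1 < ij.2)%N -> e <= r ij.1 - r ij.2.
  by apply: lt_all_pos => -[i j] /= /andP[i0 ij]; rewrite subr_gt0 r_decr.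
have [e3 e3_gt0 e3P] : exists2 e, 0 < e &
    forall ij : 'I_n * 'I_n, [&& (0 < ij.1)%N, (0 < ij.2)%N & (ij.1 + ij.2)%N == n.-1] ->
    e <= Num.min (r ij.1 ^+ 2 + r ij.2 ^+ 2 - 1 - ratr lo)
                 (ratr hi - (r ij.1 ^+ 2 + r ij.2 ^+ 2 - 1)).
  apply: lt_all_pos => -[i j] /= /and3P[i0 j0 /eqP ij].
  by have /andP[h1 h2] := sumP i j i0 j0 ij; rewrite lt_min !subr_gt0 h1.
pose e := Num.min e1 (Num.min e2 e3).
have e_gt0 : 0 < e by rewrite !lt_min e1_gt0 e2_gt0.
have [ee1 ee2 ee3] : [/\ e <= e1, e <= e2 & e <= e3].
  by rewrite /e !ge_min !lexx !orbT.
have {e1P}e1P i : (0 < i < n)%N -> e <= r i /\ e <= 1 - r i.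
  move=> /andP[i0 i1]; have := e1P (Ordinal i1) i0.
  by rewrite le_min => /andP[/= h1 h2]; split; lra.
have {e2P}e2P i j : (0 < i)%N -> (i < j)%N -> (j < n)%N -> e <= r i - r j.
  move=> i0 ij jn; have := e2P (Ordinal (ltn_trans ij jn), Ordinal jn).
  by rewrite /= i0 ij => /(_ isT); apply: le_trans.
have {e3P}e3P i j : (0 < i)%N -> (0 < j)%N -> (i + j)%N = n.-1 ->
    e <= r i ^+ 2 + r j ^+ 2 - 1 - ratr lo /\ e <= ratr hi - (r i ^+ 2 + r j ^+ 2 - 1).
  move=> i0 j0 ij; have [hi_ hj_] : (i < n)%N /\ (j < n)%N by clear -n0 i0 j0 ij; lia.
  have := e3P (Ordinal hi_, Ordinal hj_).
  rewrite /= i0 j0 ij eqxx => /(_ isT); rewrite le_min => /andP[h1 h2].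
  by split; lra.
(* Moving a point of the unit interval by d changes its square by less than 3 d, hence a sum of two
   squares by less than 6 d < e. *)
pose d := e / 8%:R.
have d_gt0 : 0 < d by rewrite divr_gt0.
(* Density of the rationals is used here; it holds in the reals but can fail in a real closed
   field. *)
have /boolp.choice[a aP] i : exists q : rat, r i - d < ratr q < r i.
  have [|q] := @rat_in_itvoo _ (r i - d) (r i).
    by rewrite ltrBlDr ltrDl.
  by rewrite in_itv; exists q.
have /boolp.choice[b bP] i : exists q : rat, r i < ratr q < r i + d.
  have [|q] := @rat_in_itvoo _ (r i) (r i + d).
    by rewrite ltrDl.
  by rewrite in_itv; exists q.
have dE : e = 8%:R * d by rewrite /d; field.
exists a, b; split.
- move=> i hi_; have [h1 h2] := e1P i hi_.
  have [/andP[a1 a2] /andP[b1 b2]] := (aP i, bP i).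
  have a0 : 0 < ratr (a i) :> R by lra.
  split.
  + by rewrite -(ltr0q R).
  + by rewrite -(ltr_rat R); lra.
  + by rewrite -(ltr_rat R) rmorph1; lra.
  + rewrite -(ltr_rat R) rmorph0 rmorphM -!horner_map /=.
    apply: (@sign_change _ n _ r e) hi_ _ _ _ _ _ => //; try lra.
    * by rewrite map_poly_eq0.
    * by rewrite size_map_poly.
    * by move=> j hj; have [_ h] := rP j hj; have [h' _] := e1P j hj.
    * by move=> j k j0 jk kn; have := e2P j k j0 jk kn; lra.
- move=> i j i0 ij jn; have := e2P i j i0 ij jn.
  have [/andP[a1 a2] /andP[b1 b2]] := (aP i, bP j).
  by rewrite -(ler_rat R); lra.
- move=> i j i0 j0 ij; have [h1 h2] := e3P i j i0 j0 ij.
  have [hi_ hj_] : (0 < i < n)%N /\ (0 < j < n)%N by clear -n0 i0 j0 ij; lia.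
  have [[hi1 hi2] [hj1 hj2]] := (e1P i hi_, e1P j hj_).
  have [/andP[ai1 ai2] /andP[bi1 bi2]] := (aP i, bP i).
  have [/andP[aj1 aj2] /andP[bj1 bj2]] := (aP j, bP j).
  have sq_lo x y : e <= y -> e <= 1 - y -> y - d < x -> y ^+ 2 - 2%:R * d <= x ^+ 2.
    by move=> ? ? ?; nra.
  have sq_hi x y : e <= y -> e <= 1 - y -> 0 < x -> x < y + d -> x ^+ 2 <= y ^+ 2 + 3%:R * d.
    by move=> ? ? ? ?; nra.
  split.
    rewrite -(ltr_rat R) !(rmorphB, rmorphD, rmorphXn, rmorph1) /=.
    by have := (sq_lo _ _ hi1 hi2 ai1, sq_lo _ _ hj1 hj2 aj1) => -[? ?]; lra.
  rewrite -(ltr_rat R) !(rmorphB, rmorphD, rmorphXn, rmorph1) /=.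
  have bi0 : 0 < ratr (b i) :> R by lra.
  have bj0 : 0 < ratr (b j) :> R by lra.
  by have := (sq_hi _ _ hi1 hi2 bi0 bi2, sq_hi _ _ hj1 hj2 bj0 bj2) => -[? ?]; lra.
Qed.

(** * Critical points over the reals *)

Lemma cheb_cos (R : realType) (x : R) k :
  (chebT R k.+1).[cos x] = cos (k.+1%:R * x) /\
  sin x * (chebU R k).[cos x] = sin (k.+1%:R * x).
Proof.
elim: k => [|k [IHT IHU]].
  by rewrite /chebT /chebU /= hornerX hornerC mulr1 mul1r.
rewrite horner_chebT_succ horner_chebU_succ IHT.
have -> : k.+2%:R * x = k.+1%:R * x + x by rewrite -(natr1 k.+1) mulrDl mul1r.
by rewrite cosD sinD -IHU -sin2cos2; split; ring.
Qed.

Lemma sinDnpi (R : realType) (x : R) k :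
  sin (k%:R * pi + x) = (-1) ^+ k * sin x /\ cos (k%:R * pi + x) = (-1) ^+ k * cos x.
Proof.
rewrite addrC mulr_natl.
by rewrite (alternatingn (@sinDpi R)) (alternatingn (@cosDpi R)).
Qed.

(** * Sine inequalities and the critical angles *)

Section SineBounds.
Variable R : realType.
Implicit Types x y : R.

Lemma sin_mvt x y : x < y -> exists2 c, x < c < y & sin y - sin x = cos c * (y - x).
Proof.
move=> xy; have [|c] := @MVT R sin cos x y xy (fun z _ => is_derive_sin z).
  by apply: continuous_subspaceT => z; apply: continuous_sin.
by rewrite in_itv; exists c.
Qed.

Lemma cos_anti x y : 0 <= x -> x <= y -> y <= pi -> cos y <= cos x.
Proof.
move=> x0; rewrite le_eqVlt => /orP[/eqP->//|xy] ypi.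
by apply/ltW; rewrite ltr_cos // in_itv /=; lra.
Qed.

Lemma sin_le x : 0 < x -> sin x <= x.
Proof.
move=> x0; have [c _] := sin_mvt 0 x x0; rewrite sin0 !subr0 => ->.
by rewrite ler_piMl ?cos_le1 // ltW.
Qed.

(** This is x <= tan x with the denominator cleared. *)
Lemma mul_cos_le_sin x : 0 < x < pi / 2%:R -> x * cos x <= sin x.
Proof.
move=> /andP[x0 xpi]; have pi0 := pi_gt0 R.
have [c /andP[c0 cx]] := sin_mvt 0 x x0; rewrite sin0 !subr0 => ->.
by rewrite mulrC ler_pM2r // cos_anti; lra.
Qed.

(** By concavity, the chord of the sine over [0, x] is at least as steep as the chord over
    [x, pi/2]; the mean value theorem expresses both slopes as cosines. *)
Lemma jordan x : 0 < x < pi / 2%:R -> x <= pi / 2%:R * sin x.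
Proof.
move=> /andP[x0 xpi]; have pi0 := pi_gt0 R.
have [c /andP[c0 cx]] := sin_mvt 0 x x0; rewrite sin0 !subr0 => sx.
have [d /andP[dx dpi]] := sin_mvt x (pi / 2%:R) xpi; rewrite sin_pihalf => s1.
have cd : cos d <= cos c by apply: cos_anti; lra.
have : (1 - sin x) * x <= sin x * (pi / 2%:R - x).
  rewrite s1 sx -!mulrA [(_ - x) * x]mulrC.
  by apply: ler_wpM2r cd; apply: mulr_ge0; lra.
lra.
Qed.

End SineBounds.

(** The last equation is tan(m x) = m tan x for m = 2n, rewritten in terms of b. The difference of
    its sides is negative at b = 0 and positive at b = pi/2, so the intermediate value theorem
    yields b. *)
Lemma critical_angle (R : realType) n i : (0 < i)%N -> (i < n)%N ->
  exists b x : R, [/\ 0 < b < pi / 2%:R, n.*2%:R * x = i%:R * pi + pi / 2%:R - b &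
    n.*2%:R * sin b * sin x = cos b * cos x].
Proof.
move=> i0 ltin.
have pi0 := pi_gt0 R.
have m0 : 0 < n.*2%:R :> R by rewrite ltr0n; lia.
have mN0 : n.*2%:R != 0 :> R by rewrite gt_eqF.
have i0' : 0 < i%:R :> R by rewrite ltr0n.
have i1 : i%:R + 1 <= n%:R :> R by rewrite natr1 ler_nat.
have mE : n.*2%:R = 2%:R * n%:R :> R by rewrite -natrM mul2n.
pose x b := (i%:R * pi + pi / 2%:R - b) / n.*2%:R : R.
pose f b := n.*2%:R * sin b * sin (x b) - cos b * cos (x b) : R.
have mx b : n.*2%:R * x b = i%:R * pi + pi / 2%:R - b by rewrite mulrC divfK.
have x_range b : 0 <= b <= pi / 2%:R -> 0 < x b < pi / 2%:R.
  move=> /andP[b0 b1]; apply/andP; split; rewrite -(ltr_pM2l m0) mx ?mulr0; first by nra.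
  by rewrite mE; nra.
have cont_x : continuous x.
  move=> b; apply: cvgM; last exact: cvg_cst.
  by apply: cvgB; [exact: cvg_cst|exact: cvg_id].
have cont_f : continuous f.
  move=> b; apply: cvgB; apply: cvgM.
  - by apply: cvgM; [exact: cvg_cst|exact: continuous_sin].
  - by apply: continuous_comp; [exact: cont_x|exact: continuous_sin].
  - exact: continuous_cos.
  - by apply: continuous_comp; [exact: cont_x|exact: continuous_cos].
have f0 : f 0 < 0.
  rewrite /f sin0 cos0 mulr0 mul0r sub0r mul1r oppr_lt0 cos_gt0_pihalf //.
  have /andP[? ?] := x_range 0 (ltac:(lra)); lra.
have f1 : 0 < f (pi / 2%:R).
  rewrite /f sin_pihalf cos_pihalf mul0r subr0 mulr1 mulr_gt0 //.
  by apply/sin_gt0_pihalf/x_range; lra.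
have [| | |b] := @IVT R f 0 (pi / 2%:R) 0.
- by lra.
- by apply: continuous_subspaceT.
- by rewrite ge_min le_max (ltW f0) (ltW f1) orbT.
rewrite in_itv /= => /andP[b0 b1] fb; exists b, (x b); split=> //.
  have bN0 : b != 0 by apply/eqP => b_eq; move: fb f0; rewrite b_eq => ->; rewrite ltxx.
  have bN1 : b != pi / 2%:R by apply/eqP => b_eq; move: fb f1; rewrite b_eq => ->; rewrite ltxx.
  by rewrite !lt_neqAle b0 b1 eq_sym bN0 bN1.
by apply/eqP; rewrite -subr_eq0 -[X in X == _]/(f b) fb.
Qed.

(** Here U_(m-1)(cos x) sin x = (-1)^i cos b and T_m(cos x) = (-1)^i sin b. In [deriv_chebU]
    multiplied by sin x, the right side vanishes by the equation for b, and the left side is sin^3 x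
    times the derivative. *)
Lemma critical_root (R : realType) n i (b x : R) : (0 < n)%N ->
  0 < x < pi / 2%:R ->
  n.*2%:R * x = i%:R * pi + pi / 2%:R - b ->
  n.*2%:R * sin b * sin x = cos b * cos x -> root (chebU R n.*2.-1)^`() (cos x).
Proof.
case: n => // n _ /sin_gt0_pihalf sx mx bx; rewrite doubleS /= in mx bx *.
have [cT sU] := cheb_cos R x n.*2.+1.
rewrite mx -addrA in cT sU.
have [hs hc] := sinDnpi R (pi / 2%:R - b) i.
rewrite hc cosB cos_pihalf sin_pihalf mul0r add0r mul1r in cT.
rewrite hs sinB cos_pihalf sin_pihalf mul0r subr0 mul1r in sU.
have /(congr1 (fun p => sin x * p.[cos x])) := deriv_chebU R n.*2.+1.
rewrite -!polyCMn !(hornerD, hornerN, hornerM, hornerC, hornerX, hornerXn) -sin2cos2 => h.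
have s3 : sin x ^+ 3 != 0 by rewrite expf_neq0 // gt_eqF.
apply/rootP/(mulfI s3); rewrite mulr0 exprS -mulrA h cT.
transitivity (cos x * (sin x * (chebU R n.*2.+1).[cos x])
   - (-1) ^+ i * (n.*2.+2%:R * sin b * sin x)); first by ring.
by rewrite sU bx; ring.
Qed.

(** For N = n and k = i, the condition k + 2 <= N excludes the last critical angle and so keeps y
    away from pi/2. The bound on N sin y is Jordan's inequality; the last one replaces sin c by c
    cos c in the equation and cancels cos c. *)
Lemma critical_angle_bounds (R : realType) (N k c y : R) :
  1 <= k -> k + 2%:R <= N -> 0 < c < pi / 2%:R ->
  2%:R * N * y = k * pi + pi / 2%:R - c ->
  2%:R * N * sin c * sin y = cos c * cos y ->
  [/\ 0 < y < pi / 2%:R, k <= N * sin y,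
      1 <= 2%:R * N ^+ 2 * c & 2%:R * N * c * sin y <= cos y].
Proof.
move=> k1 kN c_range yE cyE; have /andP[c0 c1] := c_range.
have [pi0 pi2] := (pi_gt0 R, pihalf_lt2 R).
have kpi : pi <= k * pi by rewrite ler_peMl // ltW.
have y1 : k * pi < 2%:R * N * y by lra.
have y2 : 2%:R * N * y < 2%:R * N * (pi / 2%:R) - 3%:R * (pi / 2%:R).
  have : k * pi + 2%:R * pi <= N * pi by rewrite -mulrDl ler_pM2r.
  by rewrite yE; lra.
have N0 : 0 < N by lra.
have y0 : 0 < y by rewrite -(ltr_pM2l N0) mulr0; lra.
have y_lt : y < pi / 2%:R by rewrite -(ltr_pM2l N0); lra.
have y_range : 0 < y < pi / 2%:R by rewrite y0.
have s_ge : k <= N * sin y.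
  rewrite -(ler_pM2r pi0).
  have : N * y <= N * (pi / 2%:R * sin y) by rewrite ler_pM2l // jordan.
  lra.
(* Jordan's inequality again, for cos y = sin(pi/2 - y). *)
have c_ge : 1 <= N * cos y.
  rewrite -(ler_pM2r pi0) -[cos y]mul1r -[X in X * cos y](sin_pihalf R).
  rewrite -[_ * cos y]subr0 -(mul0r (sin y)) -(cos_pihalf R) -sinB.
  have : N * (pi / 2%:R - y) <= N * (pi / 2%:R * sin (pi / 2%:R - y)).
    by rewrite ler_pM2l // jordan //; lra.
  lra.
have [sy0 cy0] : 0 < sin y /\ 0 < cos y by split; nra.
have sc0 := sin_gt0_pihalf c_range.
have cc0 : 0 < cos c by apply: cos_gt0_pihalf; lra.
have [sc1 cs1] := (cos2Dsin2 c, cos2Dsin2 y).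
split=> //.
  (* The squared equation reads 4 N^2 sin^2 c = cos^2 y + (4 N^2 - 1) sin^2 c cos^2 y, and its last
     term is nonnegative. *)
  have sc_ge : cos y <= 2%:R * N * sin c.
    rewrite -ler_sqr ?nnegrE; [|exact: ltW|by rewrite ltW // !mulr_gt0].
    rewrite !exprMn; have := congr1 (fun u => u ^+ 2) cyE; rewrite /= !exprMn.
    rewrite [cos c ^+ 2]cos2sin2 [sin y ^+ 2]sin2cos2 => h.
    have : 0 <= sin c ^+ 2 * cos y ^+ 2 * (2%:R ^+ 2 * N ^+ 2 - 1).
      by apply: mulr_ge0; [rewrite mulr_ge0 ?sqr_ge0|nra].
    lra.
  have : 2%:R * N ^+ 2 * sin c <= 2%:R * N ^+ 2 * c.
    by rewrite ler_pM2l ?sin_le // mulr_gt0 // exprn_gt0.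
  have : N * cos y <= N * (2%:R * N * sin c) by rewrite ler_pM2l.
  lra.
rewrite -(ler_pM2l cc0) -cyE; have := mul_cos_le_sin _ _ c_range => h.
have : 2%:R * N * sin y * (c * cos c) <= 2%:R * N * sin y * sin c.
  by rewrite ler_pM2l // !mulr_gt0.
lra.
Qed.

(** * Estimates for the sum of two squared critical points *)

Lemma natr_4sqrB1 (R : pzRingType) n : (0 < n)%N ->
  (4 * n ^ 2 - 1)%:R = 4%:R * n%:R ^+ 2 - 1 :> R.
Proof. by move=> n0; rewrite natrB ?muln_gt0 ?expn_gt0 ?n0 // natrM natrX. Qed.

(** In the application P = sin x sin x' and S = sin d. From above, the main term 2 P S is at most
    1/(2 N^2), and S^2 fits into 3/(10 N^2). From below, the target has order N^-4 only, so the
    crude bounds P >= (N - 2)/N^2 and S >= 1/(4 N^3) suffice. *)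
Lemma sum_estimate (R : realFieldType) (N P S : R) :
  10%:R <= N -> 0 < S -> N - 2%:R <= N ^+ 2 * P ->
  4%:R * N ^+ 2 * P * S <= 1 -> 1 <= 4%:R * N ^+ 3 * S ->
  1 / (2%:R * N ^+ 2 * (4%:R * N ^+ 2 - 1)) < S * (2%:R * P + S)
    < 3%:R / (10%:R * N ^+ 2) + 2%:R / (4%:R * N ^+ 2 - 1).
Proof.
move=> N10 S0 ss' PS_le h1.
have N0 : 0 < N by lra.
have Q0 : 0 < N ^+ 2 by apply: exprn_gt0.
have NN : 10%:R * N <= N ^+ 2 by rewrite expr2 ler_pM2r.
have M0 : 0 < 4%:R * N ^+ 2 - 1 by lra.
have S_le : (N - 2%:R) * S <= N ^+ 2 * P * S by rewrite ler_pM2r.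
apply/andP; split.
  rewrite ltr_pdivrMr ?mulr_gt0 //.
  have N3 : 0 < N ^+ 3 by apply: exprn_gt0.
  rewrite -(ltr_pM2l N3) mulr1.
  have h2 : N ^+ 3 < (N - 2%:R) * (4%:R * N ^+ 2 - 1).
    have : 10%:R * N ^+ 2 <= N ^+ 3 by rewrite exprS ler_pM2r.
    lra.
  have h3 : (N - 2%:R) * (4%:R * N ^+ 2 - 1) <= N ^+ 2 * P * (4%:R * N ^+ 2 - 1).
    by rewrite ler_pM2r.
  have h4 : N ^+ 2 * P * (4%:R * N ^+ 2 - 1) <= 4%:R * N ^+ 3 * S * (N ^+ 2 * P * (4%:R * N ^+ 2 - 1)).
    have M1 := ltW M0.
    by rewrite ler_peMl // mulr_ge0 //; lra.
  have h5 : 0 <= N ^+ 3 * S ^+ 2 * (2%:R * N ^+ 2 * (4%:R * N ^+ 2 - 1)).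
    by rewrite !mulr_ge0 ?exprn_ge0 // ltW.
  lra.
(* As N >= 10, N <= (5/4) (N - 2), while (N - 2) S <= N^2 P S <= 1/4. *)
have hS : N * S <= 5%:R / 16%:R.
  have : N * S <= (5%:R / 4%:R * (N - 2%:R)) * S by rewrite ler_pM2r //; lra.
  lra.
clear h1; have h1 : S ^+ 2 < 3%:R / (10%:R * N ^+ 2) - (1 / 10%:R) / N ^+ 2.
  rewrite (_ : _ - _ = (1 / 5%:R) / N ^+ 2); last by field; rewrite gt_eqF.
  rewrite ltr_pdivlMr // mulrC -exprMn.
  have NS0 : 0 <= N * S by rewrite mulr_ge0 // ltW.
  by have := ler_pM NS0 NS0 hS hS; rewrite -expr2; lra.
have h2 : 2%:R * P * S <= (1 / 2%:R) / N ^+ 2.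
  by rewrite ler_pdivlMr //; lra.
have h3 : (1 / 2%:R) / N ^+ 2 <= 2%:R / (4%:R * N ^+ 2 - 1).
  by rewrite ler_pdivrMr // mulrAC ler_pdivlMr //; lra.
have h4 : 0 < (1 / 10%:R) / N ^+ 2 by rewrite !divr_gt0.
lra.
Qed.

Lemma critical_sum_bounds (R : realType) n i j (b b' x x' : R) :
  (10 <= n)%N -> (0 < i)%N -> (0 < j)%N -> (i + j)%N = n.-1 ->
  0 < b < pi / 2%:R -> 0 < b' < pi / 2%:R ->
  n.*2%:R * x = i%:R * pi + pi / 2%:R - b ->
  n.*2%:R * x' = j%:R * pi + pi / 2%:R - b' ->
  n.*2%:R * sin b * sin x = cos b * cos x ->
  n.*2%:R * sin b' * sin x' = cos b' * cos x' ->
  1 / (2%:R * n%:R ^+ 2 * (4%:R * n%:R ^+ 2 - 1)) < cos x ^+ 2 + cos x' ^+ 2 - 1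
    < 3%:R / (10%:R * n%:R ^+ 2) + 2%:R / (4%:R * n%:R ^+ 2 - 1).
Proof.
move=> n10 i0 j0 ij b_range b'_range mx mx' bx bx'.
have [/andP[b0 b1] /andP[b'0 b'1]] := (b_range, b'_range).
have [pi0 pi2] := (pi_gt0 R, pihalf_lt2 R).
have [N NE] : exists N : R, N = n%:R by exists n%:R.
have N10 : 10%:R <= N by rewrite NE ler_nat.
have I1 : 1 <= i%:R :> R by rewrite ler1n.
have J1 : 1 <= j%:R :> R by rewrite ler1n.
have IJ : i%:R + j%:R + 1 = N by rewrite -natrD natr1 NE; congr (_%:R); clear -ij i0; lia.
clear ij; have mE : n.*2%:R = 2%:R * N :> R by rewrite NE -natrM mul2n.
rewrite mE in mx mx' bx bx'.
have [|/andP[x0 x1] sx bN sb] := critical_angle_bounds R N _ b x I1 _ b_range mx bx; first by lra.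
have [|/andP[x'0 x'1] sx' b'N sb'] := critical_angle_bounds R N _ b' x' J1 _ b'_range mx' bx'; first by lra.
pose d := (b + b') / (2%:R * N).
have N0 : 0 < N by lra.
have N2 : 2%:R * N != 0 by rewrite mulf_neq0 ?gt_eqF.
have dE : 2%:R * N * d = b + b' by rewrite mulrC divfK.
have sum_angle : x + x' = pi / 2%:R - d.
  by apply: (mulfI N2); rewrite !mulrDr mulrN mx mx' dE -IJ; field.
have d0 : 0 < d by rewrite divr_gt0 ?addr_gt0 ?mulr_gt0.
set s := sin x in sx sb *; set s' := sin x' in sx' sb' *.
have sE : sin d = cos x * cos x' - s * s'.
  by rewrite -cosD sum_angle cosB cos_pihalf sin_pihalf mul0r add0r mul1r.
have DE : cos x ^+ 2 + cos x' ^+ 2 - 1 = sin d * (2%:R * s * s' + sin d).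
  rewrite sE; transitivity ((cos x * cos x') ^+ 2 - (s * s') ^+ 2); last by ring.
  by rewrite !exprMn !sin2cos2; ring.
have [s0 s'0] : 0 < s /\ 0 < s' by split; rewrite -(ltr_pM2l N0) mulr0; lra.
have ss' : N - 2%:R <= N ^+ 2 * (s * s').
  (* From (i - 1) (j - 1) >= 0 comes i j >= i + j - 1 = N - 2. *)
  have : i%:R * j%:R <= (N * s) * (N * s') by apply: ler_pM.
  by have : (i%:R - 1) * (j%:R - 1) >= 0 :> R; [apply: mulr_ge0; rewrite subr_ge0 | lra].
have d_lt : d < pi / 2%:R by lra.
have sd0 : 0 < sin d by apply: sin_gt0_pihalf; lra.
have sd_le := sin_le _ _ d0.
(* Jordan's inequality with pi/2 < 2; this costs the factor 2 between [d_ge] and the bound on S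
   required by [sum_estimate]. *)
have sd_ge : d <= 2%:R * sin d.
  have := jordan R d; rewrite d0 d_lt => /(_ isT).
  have : pi / 2%:R * sin d <= 2%:R * sin d by rewrite ler_pM2r // ltW.
  lra.
(* Adding the last bounds for the two angles gives 2 N (b + b') s s' <= cos x s' + cos x' s = sin(x
   + x') <= 1. *)
have d_le : 4%:R * N ^+ 2 * (s * s') * d <= 1.
  have : cos x * s' + cos x' * s <= 1.
    by rewrite (_ : _ + _ = sin (x + x')) ?sin_le1 // sinD /s /s'; ring.
  have : 2%:R * N * b * s * s' <= cos x * s' by rewrite ler_pM2r.
  have : 2%:R * N * b' * s' * s <= cos x' * s by rewrite ler_pM2r.
  rewrite (_ : _ * d = 2%:R * N * (s * s') * (2%:R * N * d)); last by ring.
  by rewrite dE; lra.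
have d_ge : 1 <= 2%:R * N ^+ 3 * d.
  have : 2%:R <= 2%:R * N ^+ 2 * (2%:R * N * d) by rewrite dE; lra.
  lra.
rewrite DE -NE -[2%:R * s * s']mulrA; clear NE; apply: sum_estimate => //.
  by apply: le_trans d_le; rewrite ler_pM2l // !mulr_gt0 // exprn_gt0.
apply: le_trans d_ge _.
have := ler_wpM2l (ltW (exprn_gt0 3 N0)) sd_ge; lra.
Qed.

(** The angles are ordered because i pi < 2n x_i < (i+1) pi; the cosine reverses their order. *)
Lemma critical_points (R : realType) n : (10 <= n)%N -> exists r : nat -> R,
  [/\ forall i, (0 < i < n)%N -> 0 < r i < 1 /\ root (chebU R n.*2.-1)^`() (r i),
      forall i j, (0 < i)%N -> (i < j)%N -> (j < n)%N -> r j < r i &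
      forall i j, (0 < i)%N -> (0 < j)%N -> (i + j)%N = n.-1 ->
        1 / (2%:R * n%:R ^+ 2 * (4%:R * n%:R ^+ 2 - 1)) < r i ^+ 2 + r j ^+ 2 - 1
          < 3%:R / (10%:R * n%:R ^+ 2) + 2%:R / (4%:R * n%:R ^+ 2 - 1)].
Proof.
move=> n10.
have /boolp.choice[bx bxP] i : exists bx : R * R, (0 < i < n)%N ->
    [/\ 0 < bx.1 < pi / 2%:R, n.*2%:R * bx.2 = i%:R * pi + pi / 2%:R - bx.1 &
    n.*2%:R * sin bx.1 * sin bx.2 = cos bx.1 * cos bx.2].
  case: (boolP (0 < i < n)%N) => [/andP[i0 ltin]|_]; last by exists (0, 0).
  by have [b [x h]] := critical_angle R n i i0 ltin; exists (b, x).
have n0 : 0 < n.*2%:R :> R by rewrite ltr0n; lia.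
have [pi0 pi2] := (pi_gt0 R, pihalf_lt2 R).
have angle i : (0 < i < n)%N -> i%:R * pi < n.*2%:R * (bx i).2 < i.+1%:R * pi.
  move=> hi; have [/andP[b0 b1] -> _] := bxP i hi.
  by rewrite -(natr1 i) [(_ + 1) * _]mulrDl; lra.
have angle_range i : (0 < i < n)%N -> 0 < (bx i).2 < pi / 2%:R.
  move=> hi; have /andP[h1 h2] := angle i hi; apply/andP; split.
    rewrite -(ltr_pM2l n0) mulr0; apply: le_lt_trans h1.
    by rewrite mulr_ge0 ?ler0n // ltW.
  rewrite -(ltr_pM2l n0); apply: lt_le_trans h2 _.
  rewrite (_ : n.*2%:R * (pi / 2%:R) = n%:R * pi); last by rewrite -mul2n natrM; field.
  by rewrite ler_pM2r // ler_nat; lia.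
exists (fun i => cos (bx i).2); split.
- move=> i hi; have hx := angle_range i hi; have [_ e1 e2] := bxP i hi.
  split; last exact: (critical_root R n i _ _ (leq_trans _ n10) hx e1 e2).
  have /andP[x0 x1] := hx.
  rewrite cos_gt0_pihalf; last by lra.
  by rewrite -cos0 ltr_cos // in_itv /=; lra.
- move=> i j i0 ij jn.
  have [hi hj] : (0 < i < n)%N /\ (0 < j < n)%N by lia.
  have [/andP[xi0 xi1] /andP[xj0 xj1]] := (angle_range i hi, angle_range j hj).
  rewrite ltr_cos ?in_itv /=; [|lra|lra].
  rewrite -(ltr_pM2l n0); have [/andP[_ h1] /andP[h2 _]] := (angle i hi, angle j hj).
  by apply: lt_trans h1 (le_lt_trans _ h2); rewrite ler_pM2r // ler_nat.
- move=> i j i0 j0 ij.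
  have [hi hj] : (0 < i < n)%N /\ (0 < j < n)%N by lia.
  have [[bi ei fi] [bj ej fj]] := (bxP i hi, bxP j hj).
  exact: (critical_sum_bounds R n i j _ _ _ _ n10 i0 j0 ij bi bj ei ej fi fj).
Qed.

(** At 0 the derivative identity gives U'_(2n-1)(0) = -2n T_(2n)(0), which is nonzero. *)
Lemma deriv_chebU_neq0 (R : rcfType) n : (0 < n)%N -> (chebU R n.*2.-1)^`() != 0.
Proof.
case: n => // n _; rewrite doubleS /=; apply/eqP => U0.
have := congr1 (fun p => p.[0]) (deriv_chebU R n.*2.+1).
rewrite U0 mulr0 -!polyCMn !(hornerD, hornerN, hornerM, hornerC, hornerX) mul0r sub0r.
rewrite horner_coef0 -doubleS (coef_chebT_low R n.+1).1 => /esym/eqP.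
by rewrite oppr_eq0 mulf_eq0 pnatr_eq0 signr_eq0.
Qed.

Lemma ratr_bounds (R : numFieldType) n :
  (ratr (1 / (2%:R * n%:R ^+ 2 * (4%:R * n%:R ^+ 2 - 1))) : R)
    = 1 / (2%:R * n%:R ^+ 2 * (4%:R * n%:R ^+ 2 - 1)) /\
  (ratr (3%:R / (10%:R * n%:R ^+ 2) + 2%:R / (4%:R * n%:R ^+ 2 - 1)) : R)
    = 3%:R / (10%:R * n%:R ^+ 2) + 2%:R / (4%:R * n%:R ^+ 2 - 1).
Proof.
have sqr k : ratr (k%:R * n%:R ^+ 2) = k%:R * n%:R ^+ 2 :> R.
  by rewrite rmorphM rmorphXn /= !ratr_nat.
by split; rewrite ?rmorphD !fmorph_div /= ?[ratr (_ * (_ - _))]rmorphM rmorphB /= !sqr ?rmorph1 ?ratr_nat.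
Qed.

(* Rational isolating intervals and the theorem *)
From mathcomp Require Import Rstruct.

(** A concrete model of the reals enters only in the proof: the intervals, the sign changes and the
    bounds are rational and hence make sense in every real closed field. *)
Lemma rational_critical_intervals n : (10 <= n)%N -> exists (a b : nat -> rat) (p : {poly rat}),
  [/\ forall R : rcfType, (chebU R n.*2.-1)^`() = map_poly ratr p,
      forall i, (0 < i < n)%N -> [/\ 0 < a i, a i < b i, b i < 1 & p.[a i] * p.[b i] < 0],
      forall i j, (0 < i)%N -> (i < j)%N -> (j < n)%N -> b j <= a i &
      forall i j, (0 < i)%N -> (0 < j)%N -> (i + j)%N = n.-1 ->
        1 / (2%:R * n%:R ^+ 2 * (4%:R * n%:R ^+ 2 - 1)) < a i ^+ 2 + a j ^+ 2 - 1 /\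
        b i ^+ 2 + b j ^+ 2 - 1 < 3%:R / (10%:R * n%:R ^+ 2) + 2%:R / (4%:R * n%:R ^+ 2 - 1)].
Proof.
move=> n10; have n0 : (0 < n)%N by lia.
have [p pE] := chebU_over_rat n.*2.-1.
have dpE (R : rcfType) : (chebU R n.*2.-1)^`() = map_poly ratr p^`().
  by rewrite pE deriv_map.
have [r [rP r_decr r_sum]] := critical_points Rdefinitions.R n n10.
rewrite dpE in rP.
have [||x|i j i0 j0 ij|a [b [h1 h2 h3]]] := rational_isolation Rdefinitions.R n p^`()
  (1 / (2%:R * n%:R ^+ 2 * (4%:R * n%:R ^+ 2 - 1)))
  (3%:R / (10%:R * n%:R ^+ 2) + 2%:R / (4%:R * n%:R ^+ 2 - 1)) r n0 _ _ _ rP r_decr.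
- by rewrite -(map_poly_eq0 (@ratr Rdefinitions.R)) -dpE; apply: deriv_chebU_neq0.
- by rewrite -(size_map_poly (@ratr Rdefinitions.R)) -dpE; apply: size_deriv_chebU.
- by rewrite -dpE; apply: deriv_chebU_even.
- have [-> ->] := ratr_bounds Rdefinitions.R n; exact: r_sum.
by exists a, b, p^`().
Qed.

(** For x0 = z_i^2 - 2/(4n^2 - 1) and x = 1 - z_j^2, the condition x < x0 + 1/(2n^2) says that z_i^2
    + z_j^2 - 1 exceeds the right side. The left side is the form in which the lower bound was
    proved. *)
Lemma gap_splitE (R : numFieldType) n : (0 < n)%N ->
  1 / (2%:R * n%:R ^+ 2 * (4%:R * n%:R ^+ 2 - 1))
    = 2%:R / (4%:R * n%:R ^+ 2 - 1) - 1 / (2%:R * n%:R ^+ 2) :> R.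
Proof.
move=> n0; have nN0 : n%:R != 0 :> R by rewrite pnatr_eq0 -lt0n.
have mN0 : 4%:R * n%:R ^+ 2 - 1 != 0 :> R.
  by rewrite -natr_4sqrB1 // pnatr_eq0 subn_eq0 -ltnNge; nia.
by field; rewrite nN0 mN0.
Qed.

Theorem theorem4 :
  exists N : nat, forall (R : rcfType) (n : nat), (N <= n)%N ->
    forall zs : seq R,
      uniq zs ->
      (forall z : R, (z \in zs) = (0 < z) && root (chebU R n.*2.-1)^`() z) ->
      forall J : {poly R},
        (exists c : R, c != 0 /\ J = c *: \prod_(z <- zs) SU n z) ->
        forall x0 : R, root J x0 ->
          (exists y : R, root J y /\ y < x0) ->
          exists x : R, root (mutt R n) x /\
            x0 - 3%:R / (10 * n ^ 2)%:R <= x /\ x < x0 + 1 / (2 * n ^ 2)%:R.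
Proof.
(* The threshold is that of [sum_estimate]. *)
exists 10%N => R n n10 zs _ zsP J [c [c0 JE]].
have n0 : (0 < n)%N by lia.
have sqr_lt (x y : R) : 0 < x -> x < y -> x ^+ 2 < y ^+ 2.
  by move=> x0 xy; rewrite ltr_pXn2r // nnegrE ltW // (lt_trans x0).
have rootJ x : root J x -> exists2 z : R, 0 < z /\ root (chebU R n.*2.-1)^`() z &
    x = z ^+ 2 - 2%:R / (4 * n ^ 2 - 1)%:R.
  rewrite JE rootZ // => /rootP; rewrite horner_prod => /eqP.
  rewrite prodf_seq_eq0 => /hasP[z]; rewrite zsP => /andP[z0 zr] /=.
  by rewrite -rootE root_SU // => /eqP xE; exists z.
move=> x0 /rootJ[z [z_gt0 zr] ->] [y [/rootJ[w [w_gt0 wr] ->]]].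
rewrite ltrD2r => ltwz.
have [a [b [p [pE abP b_le_a ab_sum]]]] := rational_critical_intervals n n10.
(* The rational intervals now isolate the positive critical points in the given field R. *)
have [||x|i hi|i j i0 ij jn|r [rP r_decr r_all]] := isolated_roots R n (chebU R n.*2.-1)^`()
  (fun i => ratr (a i)) (fun i => ratr (b i)) n0.
- exact: deriv_chebU_neq0.
- exact: size_deriv_chebU.
- exact: deriv_chebU_even.
- have [a0 ab _ pab] := abP i hi.
  by rewrite ltr0q ltr_rat pE !horner_map -rmorphM ltrq0.
- by rewrite ler_rat b_le_a.
have [i hi zE] := r_all z z_gt0 zr; have [k hk wE] := r_all w w_gt0 wr.
(* The smaller root of J comes from a smaller critical point, that is, from a larger index; hence i
   < n-1 and the partner index j below is positive. *)
have ltik : (i < k)%N.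
  rewrite ltnNge leq_eqVlt; apply/negP => /orP[/eqP ki|ki].
    by move: ltwz; rewrite zE wE ki ltxx.
  have : r i < r k by apply: r_decr => //; lia.
  by rewrite -zE -wE => ltzw; have := sqr_lt z w z_gt0 ltzw; rewrite ltNge ltW.
pose j := (n.-1 - i)%N.
have [j0 ij] : (0 < j)%N /\ (i + j)%N = n.-1 by rewrite /j; lia.
have i0 : (0 < i)%N by lia.
have hj : (0 < j < n)%N by lia.
have [lo_a b_hi] := ab_sum i j i0 j0 ij.
have [[ai0 _ _ _] [aj0 _ bj1 _]] := (abP i hi, abP j hj).
have [[ari rbi _] [arj rbj rj_root]] := (rP i hi, rP j hj).
exists (1 - r j ^+ 2); split.
  apply: root_mutt => //; apply/andP; split.
    by apply: lt_trans arj; rewrite ltr0q.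
  by apply: lt_trans rbj _; rewrite -(rmorph1 (@ratr R)) ltr_rat.
rewrite natr_4sqrB1 // zE.
have -> : (10 * n ^ 2)%:R = 10%:R * n%:R ^+ 2 :> R by rewrite natrM natrX.
have -> : (2 * n ^ 2)%:R = 2%:R * n%:R ^+ 2 :> R by rewrite natrM natrX.
have [loE hiE] := ratr_bounds R n.
move: lo_a b_hi; rewrite -2!(ltr_rat R) loE hiE.
rewrite !(rmorphB, rmorphD, rmorphXn, rmorph1) /= => lo_a b_hi.
(* The squares of r_i and r_j lie between those of the rational endpoints, so the bounds on the
   endpoints pass to them. *)
have := sqr_lt _ _ _ ari; have := sqr_lt _ _ _ arj; have := sqr_lt _ _ _ rbi.
have := sqr_lt _ _ _ rbj; rewrite !ltr0q ai0 aj0 => hbj hbi haj hai.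
have {hai haj}[hai haj] := (hai isT, haj isT).
have {}hbi : r i ^+ 2 < ratr (b i) ^+ 2 by apply: hbi; apply: lt_trans ari; rewrite ltr0q.
have {}hbj : r j ^+ 2 < ratr (b j) ^+ 2 by apply: hbj; apply: lt_trans arj; rewrite ltr0q.
rewrite gap_splitE // in lo_a; clear - lo_a b_hi hai haj hbi hbj.
by split; lra.
Qed.
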